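(* Consider the process $\{(m_t,\sigma_t,\Sigma_t):t\ge0\}$ generated by a (1+1)-ES$_\kappa$ and assume that $f:\mathbb{R}^d\to\mathbb{R}$ is a measurable function with $d\ge2$. Let $T_\epsilon=\inf\{t:\|m_t-x^*\|\le\epsilon\}$ be the first hitting time of $[0,\epsilon]$ by $\|m_t-x^*\|$. Then the expected first hitting time is lower bounded by $$\mathbb{E}[T_\epsilon]\ge-\frac12+\frac{d}{4\kappa^{d/2}}\log\Big(\frac{\|m_0-x^*\|}{\epsilon}\Big).$$ The bound holds for arbitrary step-size adaptation mechanisms. If A1 holds, it gives a lower bound for the expected first hitting time of $f_\mu(m_t)$ to $[0,2C_\ell\epsilon]$.
   Context: $\mathcal{S}_\kappa$ ($\kappa\ge1$) is the set of symmetric positive-definite $d\times d$ matrices with determinant $1$ and condition number at most $\kappa$. The (1+1)-ES$_\kappa$ minimizing $f$, with state $(m_t,\sigma_t,\Sigma_t)\in\mathbb{R}^d\times(0,\infty)\times\mathcal{S}_\kappa$, iterates: sample $x_t\sim\mathcal{N}(m_t,\sigma_t^2\Sigma_t)$; if $f(x_t)\le f(m_t)$ set $m_{t+1}=x_t$ and $\sigma_{t+1}=\alpha_\uparrow\sigma_t$; otherwise set $m_{t+1}=m_t$ and $\sigma_{t+1}=\alpha_\downarrow\sigma_t$, where $\alpha_\uparrow>1>\alpha_\downarrow>0$; in both cases $\Sigma_{t+1}\in\mathcal{S}_\kappa$ is chosen by an arbitrary comparison-based rule (invariant to replacing $f$ by $g\circ f$ with $g$ strictly increasing). ''Arbitrary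 step-size adaptation mechanism'' means that the update of $\sigma_t$ may be replaced by any other rule. $x^*\in\mathbb{R}^d$ is the target point (the optimum), and $\epsilon>0$ is the target accuracy. Spatial suboptimality function: $f_\mu(x)=\big(\mu(\{y\in\mathbb{R}^d:f(y)\le f(x)\})\big)^{1/d}\in[0,\infty]$, $\mu$ Lebesgue measure. For $0\le a<b\le\infty$, $\mathcal{X}_a^b=\{x\in\mathbb{R}^d:a<f_\mu(x)\le b\}$. A1: $f$ is measurable and there exist $\mathcal{X}_a^b$ and constants $C_\ell,C_u>0$ such that for any $m\in\mathcal{X}_a^b$ there are an open ball $\mathcal{B}_\ell$ of radius $C_\ell f_\mu(m)$ and a closed ball $\bar{\mathcal{B}}_u$ of radius $C_uf_\mu(m)$ (arbitrary centers) with $\mathcal{B}_\ell\subseteq\{x:f_\mu(x)<f_\mu(m)\}$ and $\{x:f_\mu(x)\le f_\mu(m)\}\subseteq\bar{\mathcal{B}}_u$.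
   Formalization: In the A1 part, ε in the logarithm becomes 4C_ℓC_uε (the same right-hand side fails for the sphere, d=8), x* minimizes f, some y in X_a^b has f_μ(y) ≤ 2C_ℓε, and f_μ(m_0) ≤ b or 2C_ℓε ≤ b. *)

(* Defs.v *)
From HB Require Import structures.
From mathcomp Require Import all_boot all_order all_algebra.
From mathcomp Require Import all_classical all_reals all_analysis.

Set Implicit Arguments.
Unset Strict Implicit.
Unset Printing Implicit Defensive.

Import Order.TTheory GRing.Theory Num.Theory.
Import numFieldNormedType.Exports.

Local Open Scope classical_set_scope.
Local Open Scope ring_scope.

(* R^d is 'rV[R]_d.  Matrices carry the product sigma-algebra of their
   coordinates; over R this is the Borel sigma-algebra. *)

Definition measure_matrix_display : measure_display -> measure_display.
Proof. exact. Qed.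

Section measurable_matrix.
Context {d : measure_display} {T : measurableType d} (m n : nat).

Definition mx_cylinders : set (set 'M[T]_(m, n)) :=
  [set C | exists i j, exists2 B : set T,
     measurable B & C = [set A : 'M[T]_(m, n) | B (A i j)]].

Let mx_measurable0 : <<s mx_cylinders >> set0.
Proof. exact: sigma_algebra0. Qed.

Let mx_measurableC A : <<s mx_cylinders >> A -> <<s mx_cylinders >> (~` A).
Proof. exact: sigma_algebraC. Qed.

Let mx_measurable_bigcup (F : (set 'M[T]_(m, n))^nat) :
  (forall i, <<s mx_cylinders >> (F i)) -> <<s mx_cylinders >> (\bigcup_i F i).
Proof. exact: sigma_algebra_bigcup. Qed.

HB.instance Definition _ := @isMeasurable.Build (measure_matrix_display d)
  'M[T]_(m, n) <<s mx_cylinders >>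
  mx_measurable0 mx_measurableC mx_measurable_bigcup.

Lemma measurable_coord i j :
  measurable_fun [set: 'M[T]_(m, n)] (fun A => A i j).
Proof.
by move=> _ B mB; rewrite setTI; apply: sub_sigma_algebra; exists i, j, B.
Qed.

Lemma measurable_fun_mxP d' (S : measurableType d') (f : S -> 'M[T]_(m, n)) :
  measurable_fun setT f <-> forall i j, measurable_fun setT (fun s => f s i j).
Proof.
split=> [mf i j|mf].
  exact: (measurableT_comp (measurable_coord i j) mf).
apply: (@measurability _ _ _ _ _ _ mx_cylinders) => // _ [C [i [j [B mB ->]]] <-].
exact: mf.
Qed.

End measurable_matrix.

(* Lebesgue measure on R^n, as the n-fold product of the Lebesgue measure on
   R: the product of the measure on R and that on R^n is transported to
   R^(1 + n) by consing a coordinate. *)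
Section lebesgue.
Variable R : realType.

Definition cons_mx n (p : R * 'rV[R]_n) : 'rV[R]_(n.+1) :=
  row_mx (p.1%:M : 'rV[R]_1) p.2.

Lemma cons_mx0 n p : @cons_mx n p 0 ord0 = p.1.
Proof.
rewrite /cons_mx (_ : ord0 = lshift n (0 : 'I_1)); last exact/val_inj.
by rewrite (@row_mxEl _ 1 1 n) mxE eqxx.
Qed.

Lemma cons_mxS n p (j : 'I_n) : cons_mx p 0 (lift ord0 j) = p.2 0 j.
Proof.
rewrite /cons_mx (_ : lift ord0 j = rshift 1 j); last exact/val_inj.
by rewrite (@row_mxEr _ 1 1 n).
Qed.

Lemma measurable_cons_mx n : measurable_fun setT (@cons_mx n).
Proof.
apply/measurable_fun_mxP => i j; rewrite ord1.
have [k ->|->] := unliftP ord0 j.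
  under eq_fun do rewrite cons_mxS.
  exact: (measurableT_comp (measurable_coord 0 k) measurable_snd).
under eq_fun do rewrite cons_mx0.
exact: measurable_fst.
Qed.

Section step.
Variables (n : nat) (mu : {sigma_finite_measure set 'rV[R]_n -> \bar R}).

Definition lebesgue_step : set 'rV[R]_(n.+1) -> \bar R :=
  pushforward (lebesgue_measure \x mu)%E (@cons_mx n).

Let lebesgue_step0 : lebesgue_step set0 = 0%E.
Proof. by rewrite /lebesgue_step /pushforward preimage_set0 measure0. Qed.

Let lebesgue_step_ge0 A : (0 <= lebesgue_step A)%E.
Proof. by rewrite /lebesgue_step /pushforward measure_ge0. Qed.

Let mpre A : measurable A -> measurable (@cons_mx n @^-1` A).
Proof. by move=> mA; rewrite -[X in measurable X]setTI; exact: measurable_cons_mx. Qed.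

Let lebesgue_step_sigma_additive : semi_sigma_additive lebesgue_step.
Proof.
move=> F mF tF mUF; rewrite /lebesgue_step /pushforward preimage_bigcup.
apply: measure_semi_sigma_additive.
- by move=> k; exact: mpre.
- apply/trivIsetP => /= i j _ _ ij; rewrite -preimage_setI.
  by move/trivIsetP : tF => /(_ _ _ _ _ ij) ->//; rewrite preimage_set0.
- by rewrite -preimage_bigcup; exact: mpre.
Qed.

HB.instance Definition _ := isMeasure.Build _ _ _ lebesgue_step
  lebesgue_step0 lebesgue_step_ge0 lebesgue_step_sigma_additive.

Let lebesgue_step_sigma_finite : sigma_finite setT lebesgue_step.
Proof.
have /sigma_finiteP[F [TF ndF Foo]] := sigma_finiteT (@lebesgue_measure R).
have /sigma_finiteP[G [TG ndG Goo]] := sigma_finiteT mu.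
pose H k := [set x : 'rV[R]_n.+1 |
  F k (x 0 ord0) /\ G k (\row_j x 0 (lift ord0 j))].
have HE k : @cons_mx n @^-1` H k = F k `*` G k.
  rewrite /H; apply/seteqP; split=> -[a b] /=;
  rewrite cons_mx0 (_ : \row_j _ = b)//;
  by apply/rowP => j; rewrite mxE cons_mxS.
exists H.
  apply/esym/seteqP; split=> // x _.
  have [i _ Fi] : (\bigcup_i F i) (x 0 ord0) by rewrite -TF.
  have [j _ Gj] : (\bigcup_i G i) (\row_j x 0 (lift ord0 j)) by rewrite -TG.
  exists (maxn i j) => //; split.
    by move: Fi; exact/subsetPset/ndF/leq_maxl.
  by move: Gj; exact/subsetPset/ndG/leq_maxr.
move=> k; have [mF Fk] := Foo k; have [mG Gk] := Goo k; split; last first.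
  rewrite /lebesgue_step /pushforward HE product_measure1E//.
  by rewrite lte_mul_pinfty// ge0_fin_numE.
apply: measurableI.
  by rewrite -[X in measurable X]setTI; exact: measurable_coord.
rewrite -[X in measurable X]setTI.
apply: (_ : measurable_fun setT
  (fun x : 'rV[R]_n.+1 => \row_j x 0 (lift ord0 j))) => //.
apply/measurable_fun_mxP => i j; under eq_fun do rewrite mxE.
exact: measurable_coord.
Qed.

HB.instance Definition _ := Measure_isSigmaFinite.Build _ _ _ lebesgue_step
  lebesgue_step_sigma_finite.

End step.

Fixpoint lebesgue_rV (n : nat) : {sigma_finite_measure set 'rV[R]_n -> \bar R} :=
  match n with
  | 0 => \d_(0 : 'rV[R]_0)
  | n'.+1 => lebesgue_step (lebesgue_rV n')
  end.

Lemma lebesgue_rV_box n (A : 'I_n -> set R) :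
  (forall i, measurable (A i)) ->
  lebesgue_rV n [set x | forall i, A i (x 0 i)] =
  (\prod_(i < n) lebesgue_measure (A i))%E.
Proof.
elim: n A => [|n IH] A mA.
  rewrite big_ord0 /= diracE mem_set//; by case.
rewrite big_ord_recl -IH//= /lebesgue_step /pushforward.
rewrite -product_measure1E//.
  congr (_ _); apply/seteqP; split=> -[a b] /=.
    move=> H; split; first by have := H ord0; rewrite cons_mx0.
    by move=> i; have := H (lift ord0 i); rewrite cons_mxS.
  move=> [H0 H] i; have [k ->|->] := unliftP ord0 i.
    by rewrite cons_mxS; exact: H.
  by rewrite cons_mx0.
  exact: mA.
rewrite -[X in measurable X]/[set x : 'rV[R]_n | forall i, A (lift ord0 i) (x 0 i)].
have -> : [set x : 'rV[R]_n | forall i, A (lift ord0 i) (x 0 i)] =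
    \bigcap_(i in [set: 'I_n]) [set x : 'rV[R]_n | A (lift ord0 i) (x 0 i)].
  by apply/seteqP; split=> x /= H i; [move=> _|]; exact: H.
apply: fin_bigcap_measurable => // i _.
by rewrite -[X in measurable X]setTI; exact: measurable_coord.
Qed.

End lebesgue.

Section euclidean.
Context {R : realType} {d : nat}.
Implicit Types (x m c : 'rV[R]_d) (S C : 'M[R]_d) (f : 'rV[R]_d -> R).

(* The library norm on 'rV[R]_d is the sup norm. *)
Definition enorm x : R := Num.sqrt (\sum_(i < d) x 0 i ^+ 2).

Definition sym_posdef : set 'M[R]_d :=
  [set S | S^T = S /\ forall v : 'rV[R]_d, v != 0 -> 0 < (v *m S *m v^T) 0 0].

(* Largest over smallest eigenvalue; only used on [sym_posdef], where the
   spectrum is a nonempty finite set of positive reals. *)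
Definition cond_number S : R :=
  sup [set a | eigenvalue S a] / inf [set a | eigenvalue S a].

Definition S_kappa (kappa : R) : set 'M[R]_d :=
  [set S | [/\ sym_posdef S, \det S = 1 & cond_number S <= kappa]].

Definition gauss_pdf m C x : R :=
  (Num.sqrt ((2 * pi) ^+ d * \det C))^-1 *
  expR (- ((x - m) *m invmx C *m (x - m)^T) 0 0 / 2).

Definition gauss m C (B : set 'rV[R]_d) : \bar R :=
  (\int[lebesgue_rV R d]_(x in B) (gauss_pdf m C x)%:E)%E.

Definition f_mu f x : \bar R :=
  (lebesgue_rV R d [set y | (f y <= f x)%R] `^ (d%:R^-1))%E.

Definition level_band f (a b : \bar R) : set 'rV[R]_d :=
  [set x | (a < f_mu f x <= b)%E].

(* The part of A1 that follows the choice of the band and of the constants. *)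
Definition A1 f (a b : \bar R) (Cl Cu : R) : Prop :=
  forall m, level_band f a b m -> exists cl cu : 'rV[R]_d,
    [set x | ((enorm (x - cl))%:E < Cl%:E * f_mu f m)%E]
      `<=` [set x | (f_mu f x < f_mu f m)%E] /\
    [set x | (f_mu f x <= f_mu f m)%E]
      `<=` [set x | ((enorm (x - cu))%:E <= Cu%:E * f_mu f m)%E].

End euclidean.

Section evolution_strategy.
Context {R : realType} {d : nat}.

(* Everything available in one iteration: the state, the sampled point and
   auxiliary data of an arbitrary type [U] (e.g. internal randomness of the
   update rules). *)
Record iteration (U : Type) := Iteration {
  mean : 'rV[R]_d ;
  step_size : R ;
  cov_matrix : 'M[R]_d ;
  sample : 'rV[R]_d ;
  auxiliary : U }.

(* [rule f past cur] is the next value, given the objective function, the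
   iterations 0, ..., t-1 (in this order) and the iteration t. *)
Definition update_rule (U : Type) (V : Type) :=
  ('rV[R]_d -> R) -> seq (iteration U) -> iteration U -> V.

Definition comparison_based U V (rule : update_rule U V) : Prop :=
  forall (f : 'rV[R]_d -> R) (g : R -> R), {homo g : a b / a < b} ->
  forall past cur, rule (g \o f) past cur = rule f past cur.

Definition success_rule U (alpha_up alpha_down : R) : update_rule U R :=
  fun f past cur =>
    if f (sample cur) <= f (mean cur) then alpha_up * step_size cur
    else alpha_down * step_size cur.

Context {dO : measure_display} {Omega : measurableType dO}.

Definition filtration (F : nat -> set (set Omega)) : Prop :=
  forall t, [/\ sigma_algebra setT (F t), F t `<=` measurable
              & F t `<=` F t.+1].

Definition measurable_wrt (G : set (set Omega)) d' (T : measurableType d')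
    (X : Omega -> T) : Prop :=
  forall B, measurable B -> G (X @^-1` B).

(* The (1+1)-ES_kappa on f with step-size rule [srule] and covariance rule
   [crule].  [F t] is the information available before x_t is drawn;
   [es_sample] says that the conditional law of x_t given [F t] is
   N(m_t, sigma_t^2 Sigma_t). *)
Record ES_process (P : probability Omega R) (U : Type) (kappa : R)
    (f : 'rV[R]_d -> R) (srule : update_rule U R)
    (crule : update_rule U 'M[R]_d) (F : nat -> set (set Omega))
    (m : nat -> Omega -> 'rV[R]_d) (sigma : nat -> Omega -> R)
    (Sigma : nat -> Omega -> 'M[R]_d) (x : nat -> Omega -> 'rV[R]_d)
    (u : nat -> Omega -> U) : Prop := {
  es_filtration : filtration F ;
  es_mean_adapted : forall t, measurable_wrt (F t) (m t) ;
  es_step_size_adapted : forall t, measurable_wrt (F t) (sigma t) ;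
  es_covariance_adapted : forall t, measurable_wrt (F t) (Sigma t) ;
  es_sample_adapted : forall t, measurable_wrt (F t.+1) (x t) ;
  es_step_size_gt0 : forall t w, 0 < sigma t w ;
  es_covariance_S_kappa : forall t w, S_kappa kappa (Sigma t w) ;
  es_sample : forall t (A : set Omega) (B : set 'rV[R]_d),
    F t A -> measurable B ->
    P (A `&` x t @^-1` B) =
    (\int[P]_(w in A) gauss (m t w) (sigma t w ^+ 2 *: Sigma t w) B)%E ;
  es_mean_update : forall t w,
    m t.+1 w = if f (x t w) <= f (m t w) then x t w else m t w ;
  es_step_size_update : forall t w,
    let it k := Iteration (m k w) (sigma k w) (Sigma k w) (x k w) (u k w) in
    sigma t.+1 w = srule f (mkseq it t) (it t) ;
  es_covariance_update : forall t w,
    let it k := Iteration (m k w) (sigma k w) (Sigma k w) (x k w) (u k w) in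
    Sigma t.+1 w = crule f (mkseq it t) (it t) }.

(* Infinite on the paths that never enter D. *)
Definition hitting_time (V : Type) (Y : nat -> Omega -> V) (D : set V)
    (w : Omega) : \bar R :=
  ereal_inf [set (t%:R)%:E | t in [set t | D (Y t w)]].

End evolution_strategy.

(* Main.v *)
(* Put [D_t = |m_t - xstar|] and choose levels [l_0 = eps, l_1, ..., l_(J-1)] below
   [D_0] such that [l_j ^ d] doubles at each step.  To reach [eps], the mean has
   to cross every level, and crossing [l_j] at time [t] means that [D_t > l_j]
   and that the sample lands in the ball of radius [l_j] around [xstar].

   The probability of that event is at most [kappa ^ (d/2) * (l_j / D_t) ^ d],
   whatever the step size: on the ball, the density of N(m, v I) is at most
   [rho ^ d] times that of N(xstar + rho^2 (m - xstar), rho^2 v I), where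
   [rho = l_j / |m - xstar|], because the ball is an Apollonius ball of the two
   centers; and the density of N(m, s^2 Sigma) is at most [kappa ^ (d/2)] times
   that of N(m, kappa s^2 I).

   Summing the geometric series over [l_j < D_t], at most [2 kappa ^ (d/2)]
   levels are crossed per iteration in expectation, so the expected hitting
   time is at least [J / (2 kappa ^ (d/2))]. *)
Require Import Defs.
From HB Require Import structures.
From mathcomp Require Import all_boot all_order all_algebra.
From mathcomp Require Import all_classical all_reals all_analysis.
From mathcomp Require Import measurable_realfun complex ring lra.

Set Implicit Arguments.
Unset Strict Implicit.
Unset Printing Implicit Defensive.

Import Order.TTheory GRing.Theory Num.Theory.
Import numFieldNormedType.Exports.

Local Open Scope classical_set_scope.
Local Open Scope ring_scope.

(** * Spectral theory of real symmetric matrices *)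

Section spectral_decomposition.
Variables (R : realType) (d : nat).
Implicit Types (S : 'M[R]_d) (v : 'rV[R]_d).

Local Notation toC := (real_complex R).
Local Notation adj M := (map_mx Num.conj M^T).

(** Over [R[i]] the matrix is Hermitian, hence unitarily diagonalizable with real eigenvalues [a];
    [P] itself may be complex. *)
Lemma symmetric_spectral S : S^T = S ->
  exists (P : 'M[R[i]]_d) (a : 'rV[R]_d),
    [/\ P *m adj P = 1%:M, adj P *m P = 1%:M &
        map_mx toC S = adj P *m diag_mx (map_mx toC a) *m P].
Proof.
move=> Ssym; pose A := map_mx toC S.
have Asym : A \is symmetricmx.
  by apply/is_hermitianmxP; rewrite expr0 scale1r map_mx_id// /A map_trmx Ssym.
have Areal : A \is a realmx.
  by apply/mxOverP => i j; rewrite mxE; apply/complex_realP; exists (S i j).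
have Aherm := realsym_hermsym Asym Areal.
have Ereal := hermitian_spectral_diag_real Aherm.
have /orthomx_spectralP AE := hermitian_normalmx Aherm.
have Pu := spectral_unitarymx A.
exists (spectralmx A), (map_mx (@complex.Re R) (spectral_diag A)).
rewrite -invmx_unitary// mulmxV ?spectral_unit// mulVmx ?spectral_unit//.
split=> //; rewrite -map_mx_comp [X in diag_mx X]map_mx_id_in //=.
by move=> i j; apply: RRe_real; apply/mxOverP.
Qed.

(** In the coordinates [w = v *m adj P], the quadratic forms of [S *m S] and [S] are the sums of
    [a_i^2 |w_i|^2] and of [a_i |w_i|^2], and [a_i^2 <= k a_i]. *)
Lemma spectral_bounds S : S^T = S -> exists a : 'rV[R]_d,
  [/\ \det S = \prod_i a 0 i,
      [set b | eigenvalue S b] = range (a 0) &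
      forall (k : R) v, (forall i, 0 <= a 0 i <= k) ->
        (v *m S *m S *m v^T) 0 0 <= k * (v *m S *m v^T) 0 0].
Proof.
move=> /symmetric_spectral[P [a [PP' P'P SE]]]; exists a.
set D := diag_mx _ in SE.
have SP' : map_mx toC S *m adj P = adj P *m D.
  by rewrite SE -!mulmxA PP' mulmx1.
have PS : P *m map_mx toC S = D *m P by rewrite SE !mulmxA PP' mul1mx.
split.
- apply: complexI; rewrite -det_map_mx SE !det_mulmx mulrAC -det_mulmx P'P.
  rewrite det1 mul1r det_diag rmorph_prod.
  by apply: eq_bigr => i _; rewrite mxE.
- apply/seteqP; split=> [b /eigenvalueP[v vS v0]|_ [i _ <-] /=].
    pose w := map_mx toC v *m adj P.
    have wE : w *m D = toC b *: w.
      by rewrite /w -mulmxA -SP' mulmxA -map_mxM vS map_mxZ scalemxAl.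
    have : w != 0.
      apply: contra_neq v0 => w0; apply/eqP.
      by rewrite -(map_mx_eq0 toC) -[map_mx _ _]mulmx1 -P'P mulmxA -/w w0 mul0mx.
    move=> /rV0Pn[i wi]; exists i => //.
    apply: complexI; apply: (mulfI wi).
    have /rowP/(_ i) := wE; rewrite mul_mx_diag !mxE => ->.
    by rewrite mulrC.
  rewrite -(eigenvalue_map toC); apply/eigenvalueP; exists (row i P).
    rewrite -row_mul PS; apply/rowP => j.
    by rewrite mul_diag_mx !mxE.
  apply/negP => /eqP Pi0; have /matrixP/(_ i i) := PP'.
  rewrite !mxE eqxx big1 => [/esym/eqP|j _]; first by rewrite oner_eq0.
  by have /rowP/(_ j) := Pi0; rewrite !mxE => ->; rewrite mul0r.
- move=> k v ak; rewrite -lecR.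
  pose w := map_mx toC v *m adj P.
  have wT : adj w = P *m map_mx toC v^T.
    rewrite /w trmx_mul map_mxM map_trmx trmxK -map_mx_comp.
    rewrite (map_mx_id (@conjCK _)); congr (_ *m _).
    by apply/matrixP => i j; rewrite !mxE; apply: conj_Creal; apply/complex_realP; eexists.
  have -> : toC ((v *m S *m S *m v^T) 0 0) =
      \sum_i toC (a 0 i ^+ 2) * `|w 0 i| ^+ 2.
    have -> : toC ((v *m S *m S *m v^T) 0 0) = (w *m D *m D *m adj w) 0 0.
      rewrite wT mulmxA -[w *m D *m D *m P]mulmxA -PS -[w *m D *m _]mulmxA.
      rewrite (mulmxA D) -PS !mulmxA /w -[_ *m adj P *m P]mulmxA P'P mulmx1.
      by rewrite -!map_mxM [RHS]mxE.
    rewrite mxE; apply: eq_bigr => i _; rewrite !mul_mx_diag !mxE normCK rmorphXn.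
    ring.
  have -> : toC (k * (v *m S *m v^T) 0 0) =
      \sum_i toC (k * a 0 i) * `|w 0 i| ^+ 2.
    have -> : toC (k * (v *m S *m v^T) 0 0) = toC k * (w *m D *m adj w) 0 0.
      rewrite wT mulmxA -[w *m D *m P]mulmxA -PS.
      rewrite !mulmxA /w -[_ *m adj P *m P]mulmxA P'P mulmx1.
      by rewrite -!map_mxM rmorphM; congr (_ * _); rewrite [RHS]mxE.
    rewrite mxE big_distrr; apply: eq_bigr => i _.
    rewrite !mul_mx_diag !mxE normCK rmorphM /=.
    ring.
  apply: ler_sum => i _; apply: ler_wpM2r; first by rewrite exprn_ge0.
  rewrite lecR expr2; have /andP[a0 ai] := ak i.
  exact: ler_wpM2r.
Qed.

End spectral_decomposition.

(* As [\det S = 1], the smallest eigenvalue is at most 1, so the largest one is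
   at most [kappa]. *)
Lemma S_kappa_quadratic (R : realType) (d : nat) (kappa : R) (S : 'M[R]_d)
    (y : 'rV[R]_d) : (0 < d)%N -> S_kappa kappa S ->
  \sum_i y 0 i ^+ 2 <= kappa * (y *m invmx S *m y^T) 0 0.
Proof.
move=> d0 [[Ssym Spos] detS condS].
have [a [detE eigE quad]] := spectral_bounds Ssym.
rewrite /cond_number eigE in condS.
have sqE (v : 'rV[R]_d) : (v *m v^T) 0 0 = \sum_i v 0 i ^+ 2.
  by rewrite mxE; apply: eq_bigr => i _; rewrite mxE expr2.
have a_gt0 i : 0 < a 0 i.
  have : range (a 0) (a 0 i) by exists i.
  rewrite -eigE => /eigenvalueP[v vS /Spos].
  rewrite vS -scalemxAl mxE sqE; apply: contraTT; rewrite -!leNgt => ai.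
  by rewrite mulr_le0_ge0// sumr_ge0// => j _; exact: sqr_ge0.
have [i1 ai1] : exists i, a 0 i <= 1.
  apply: contrapT => /forallNP a1.
  have : \prod_(i < d) 1 < \prod_i a 0 i.
    apply: ltr_prod => [|i _]; last by rewrite ler01 ltNge; apply/negP.
    by apply/hasP; exists (Ordinal d0); rewrite ?mem_index_enum.
  by rewrite -detE detS big1_eq ltxx.
pose imin := [arg min_(i < i1) a 0 i]%O.
have aminP i : a 0 imin <= a 0 i.
  by rewrite /imin; case: arg_minP => // j _; apply.
pose imax := [arg max_(i > i1) a 0 i]%O.
have amaxP i : a 0 i <= a 0 imax.
  by rewrite /imax; case: arg_maxP => // j _; apply.
have inf_gt0 : 0 < inf (range (a 0)).
  apply: lt_le_trans (a_gt0 imin) _; apply: lb_le_inf; first by exists (a 0 i1), i1.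
  by move=> _ [i _ <-].
have inf_le1 : inf (range (a 0)) <= 1.
  apply: le_trans ai1; apply: ge_inf; last by exists i1.
  by exists (a 0 imin) => _ [i _ <-].
have ak i : 0 <= a 0 i <= kappa.
  rewrite ltW//=; apply: (@le_trans _ _ (sup (range (a 0)))).
    apply: ub_le_sup; last by exists i.
    by exists (a 0 imax) => _ [j _ <-].
  move: (condS); rewrite ler_pdivrMr// => /le_trans; apply.
  apply: ler_piMr => //.
  (* Positivity of [kappa], an upper bound of a positive quotient, turns [inf <= 1] into
     [kappa * inf <= kappa]. *)
  have : 0 < sup (range (a 0)) / inf (range (a 0)).
    rewrite divr_gt0//; apply: lt_le_trans (a_gt0 i1) _.
    apply: ub_le_sup; last by exists i1.
    by exists (a 0 imax) => _ [j _ <-].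
  by move/lt_le_trans => /(_ _ condS)/ltW.
have Sunit : S \in unitmx by rewrite unitmxE detS unitr1.
(* Evaluated at [y *m invmx S], the form of [S *m S] is [|y|^2] and that of [S] is the form of
   [invmx S] at [y]. *)
have := quad kappa (y *m invmx S) ak.
rewrite mulmxKV// -sqE trmx_mul trmx_inv Ssym !mulmxA.
by rewrite mulmxK.
Qed.

(** * Integration over [R^n] *)

(* The integral of a nonnegative function is the supremum over the simple
   functions below it, measurable or not. *)
Lemma ge0_le_integral_nonmeasurable d (T : measurableType d) (R : realType)
    (mu : {measure set T -> \bar R}) (f g : T -> \bar R) :
  (forall x, 0 <= f x)%E -> (forall x, f x <= g x)%E ->
  (\int[mu]_x f x <= \int[mu]_x g x)%E.
Proof.
move=> f0 fg; have g0 x : (0 <= g x)%E by exact: le_trans (fg x).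
rewrite !ge0_integralTE//; apply: ge_ereal_sup => _ [h hf <-].
by apply: ereal_sup_ubound; exists h => // x; exact: le_trans (fg x).
Qed.

(** Tonelli, one coordinate at a time: the measure on [R^(n+1)] is the image of a product measure
    under [cons_mx]. *)
Lemma integral_rV_prod (R : realType) n (g : 'I_n -> R -> R) :
  (forall i, measurable_fun setT (g i)) -> (forall i x, 0 <= g i x) ->
  (\int[lebesgue_rV R n]_x (\prod_i g i (x 0 i))%:E =
   \prod_i \int[lebesgue_measure]_x (g i x)%:E)%E.
Proof.
elim: n g => [|n IH] g mg g0.
  rewrite big_ord0 /=; under eq_integral do rewrite big_ord0.
  by rewrite integral_cst//= diracT mule1.
have mprod k (h : 'I_k -> R -> R) : (forall i, measurable_fun setT (h i)) ->
    measurable_fun setT (fun x : 'rV[R]_k => \prod_i h i (x 0 i)).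
  move=> mh; apply: measurable_prod => i _.
  exact: (measurableT_comp (mh i) (measurable_coord 0 i)).
pose G (x : 'rV[R]_n.+1) : \bar R := (\prod_i g i (x 0 i))%:E.
have mG : measurable_fun setT G.
  by apply/measurable_EFinP; exact: mprod mg.
have G0 x : (0 <= G x)%E.
  by rewrite lee_fin prodr_ge0.
have mcons := @measurable_cons_mx R n.
transitivity (\int[pushforward (lebesgue_measure \x lebesgue_rV R n)%E
    (@cons_mx R n)]_x G x)%E.
  exact: eq_measure_integral.
rewrite ge0_integral_pushforward// preimage_setT /=.
rewrite fubini_tonelli1//=; last exact: measurableT_comp mG mcons.
rewrite /fubini_F /=.
rewrite big_ord_recl -IH//.
under eq_integral => a _.
  rewrite [X in integral _ _ X](_ : _ = fun y : 'rV[R]_n =>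
      (g ord0 a)%:E * (\prod_i g (lift ord0 i) (y 0 i))%:E)%E; last first.
    apply/funext => b; rewrite /G big_ord_recl cons_mx0 EFinM; congr (_ * (_%:E))%E.
    by apply: eq_bigr => i _; rewrite cons_mxS.
  rewrite ge0_integralZl_EFin//; [|by move=> y _; rewrite lee_fin prodr_ge0|
    by apply/measurable_EFinP; exact: (mprod _ (fun i => g (lift ord0 i)))].
  over.
rewrite ge0_integralZr//.
- by apply/measurable_EFinP; exact: mg.
- by move=> a _; rewrite lee_fin.
- by apply: integral_ge0 => y _; rewrite lee_fin prodr_ge0.
Qed.

(** * Euclidean geometry *)

Section enorm_geometry.
Variables (R : realType) (d : nat).
Implicit Types (x m c : 'rV[R]_d).

Lemma enorm_ge0 x : 0 <= enorm x.
Proof. exact: sqrtr_ge0. Qed.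

Lemma enorm_sqr x : enorm x ^+ 2 = \sum_(i < d) x 0 i ^+ 2.
Proof. by rewrite sqr_sqrtr// sumr_ge0// => i _; exact: sqr_ge0. Qed.

(* Apollonius: the ball of radius [rho |v|] is the set of points whose distance
   to [rho^2 v] is at most [rho] times the distance to [v]. *)
Lemma apollonius (rho : R) (u v : 'rV[R]_d) : 0 <= rho <= 1 ->
  enorm u <= rho * enorm v ->
  enorm (u - rho ^+ 2 *: v) ^+ 2 <= rho ^+ 2 * enorm (u - v) ^+ 2.
Proof.
move=> /andP[rho0 rho1] uv.
have {}uv : enorm u ^+ 2 <= rho ^+ 2 * enorm v ^+ 2.
  by rewrite -exprMn lerXn2r// ?nnegrE ?mulr_ge0// enorm_ge0.
rewrite -subr_ge0.
have -> : rho ^+ 2 * enorm (u - v) ^+ 2 - enorm (u - rho ^+ 2 *: v) ^+ 2 =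
    (1 - rho ^+ 2) * (rho ^+ 2 * enorm v ^+ 2 - enorm u ^+ 2).
  rewrite !enorm_sqr !mulr_sumr -!sumrB mulr_sumr; apply: eq_bigr => i _.
  by rewrite !mxE; ring.
by rewrite mulr_ge0// subr_ge0// expr_le1.
Qed.

End enorm_geometry.

(** * Gaussian mass of a ball *)

Section gaussian_ball.
Variables (R : realType) (d : nat).
Implicit Types (x m c : 'rV[R]_d).

(** Both density comparisons are made at once. The product on the right is the density of the normal
    law with center [xs + rho^2 (m - xs)] and covariance [rho^2 kappa sg^2 I]. *)
Lemma gauss_pdf_le (kappa sg rho : R) (S : 'M[R]_d) m x xs :
  (0 < d)%N -> 0 < kappa -> S_kappa kappa S -> 0 < sg -> 0 < rho <= 1 ->
  enorm (x - xs) <= rho * enorm (m - xs) ->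
  gauss_pdf m (sg ^+ 2 *: S) x <= (Num.sqrt kappa * rho) ^+ d *
    \prod_i normal_pdf ((xs + rho ^+ 2 *: (m - xs)) 0 i)
              (rho * Num.sqrt kappa * sg) (x 0 i).
Proof.
move=> d0 k0 Sk sg0 /andP[rho0 rho1] xball.
have [_ detS _] := Sk.
set s := rho * Num.sqrt kappa * sg; set c := xs + _.
have sk0 : 0 < Num.sqrt kappa by rewrite sqrtr_gt0.
have s0 : 0 < s by rewrite !mulr_gt0.
have Sunit : sg ^+ 2 *: S \in unitmx.
  by rewrite unitmxE detZ detS mulr1 unitfE !expf_neq0// gt_eqF.
have -> : \prod_i normal_pdf (c 0 i) s (x 0 i) =
    normal_peak s ^+ d * expR (- enorm (x - c) ^+ 2 / (s ^+ 2 *+ 2)).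
  under eq_bigr do rewrite normal_pdfE ?gt_eqF//.
  rewrite big_split/= prodr_const card_ord; congr (_ * _).
  rewrite -expR_sum enorm_sqr -sumrN mulr_suml; congr expR.
  by apply: eq_bigr => i _; rewrite !mxE.
rewrite mulrA; apply: ler_pM; rewrite ?expR_ge0//.
(* As [\det S = 1], the normalizing constants differ exactly by the factor
   [(sqrt kappa * rho)^d]. *)
- rewrite detZ detS mulr1 -exprMn.
  have -> : (2 * pi * sg ^+ 2) ^+ d = (Num.sqrt (2 * pi * sg ^+ 2) ^+ d) ^+ 2.
    have v0 : 0 <= 2 * pi * sg ^+ 2 by rewrite mulr_ge0 ?sqr_ge0// mulr_ge0 ?pi_ge0.
    by rewrite -exprM mulnC exprM sqr_sqrtr.
  rewrite sqrtr_sqr ger0_norm ?exprn_ge0 ?sqrtr_ge0// -exprVn -exprMn.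
  apply: lerXn2r; rewrite ?nnegrE ?invr_ge0 ?sqrtr_ge0//.
    by rewrite mulr_ge0 ?normal_peak_ge0// mulr_ge0// ltW.
  have -> : normal_peak s = (Num.sqrt kappa * rho)^-1 *
      (Num.sqrt (2 * pi * sg ^+ 2))^-1.
    rewrite /normal_peak -invfM; congr (_^-1).
    rewrite (_ : s ^+ 2 * pi *+ 2 =
      (Num.sqrt kappa * rho) ^+ 2 * (2 * pi * sg ^+ 2)); last by rewrite /s; ring.
    by rewrite sqrtrM ?sqr_ge0// sqrtr_sqr gtr0_norm// mulr_gt0.
  by rewrite mulVKf// mulf_neq0// gt_eqF.
(* Exponents: [|x - c|^2 <= rho^2 |x - m|^2 <= rho^2 kappa q], divided by
   [2 s^2 = 2 rho^2 kappa sg^2]. *)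
- rewrite ler_expR !mulNr lerN2.
  have quad := S_kappa_quadratic (x - m) d0 Sk.
  rewrite invmxZ// -scalemxAr -scalemxAl mxE.
  set q := (_ *m _ *m _) 0 0 in quad *; rewrite -enorm_sqr in quad.
  have rho01 : 0 <= rho <= 1 by rewrite ltW.
  have := apollonius rho01 xball.
  rewrite (_ : _ - _ - _ = x - c); last by rewrite /c opprD addrA.
  rewrite (_ : x - xs - (m - xs) = x - m); last by rewrite opprB addrA subrK.
  move=> /le_trans/(_ (ler_wpM2l (sqr_ge0 rho) quad)) => cq.
  rewrite ler_pdivrMr ?pmulrn_lgt0 ?exprn_gt0//.
  apply: (le_trans cq); rewrite /s !exprMn sqr_sqrtr ?(ltW k0)//.
  rewrite le_eqVlt; apply/orP; left; apply/eqP.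
  by field; rewrite gt_eqF.
Qed.

Lemma measurable_enorm xs : measurable_fun setT (fun x : 'rV[R]_d => enorm (x - xs)).
Proof.
apply: (measurableT_comp (continuous_measurable_fun (@sqrt_continuous R))).
under eq_fun do under eq_bigr do rewrite !mxE.
apply: (@measurable_sum _ _ _ _ _ _ (fun i (x : 'rV[R]_d) => (x 0 i - xs 0 i) ^+ 2)) => i.
by apply/measurable_funX/measurable_funB => //; exact: measurable_coord.
Qed.

(** The pointwise bound with [rho = l / |m - xs|] is integrated, and the domain enlarged from the
    ball to [R^d], where the comparison density has mass 1. *)
Lemma gauss_ball_le (kappa sg l : R) (S : 'M[R]_d) m xs :
  (0 < d)%N -> 0 < kappa -> S_kappa kappa S -> 0 < sg -> 0 < l <= enorm (m - xs) ->
  (gauss m (sg ^+ 2 *: S) [set x | (enorm (x - xs) <= l)%R] <=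
   (Num.sqrt kappa ^+ d * (l / enorm (m - xs)) ^+ d)%:E)%E.
Proof.
move=> d0 k0 Sk sg0 /andP[l0 lm]; pose rho := l / enorm (m - xs).
have D0 : 0 < enorm (m - xs) by exact: lt_le_trans lm.
have rho01 : 0 < rho <= 1 by rewrite divr_gt0//= ler_pdivrMr// mul1r.
rewrite /gauss integral_mkcond.
pose g i := normal_pdf ((xs + rho ^+ 2 *: (m - xs)) 0 i) (rho * Num.sqrt kappa * sg).
have pg0 x : 0 <= \prod_i g i (x 0 i).
  by rewrite prodr_ge0// => i _; exact: normal_pdf_ge0.
apply: (@le_trans _ _ (\int[lebesgue_rV R d]_x
   (((Num.sqrt kappa * rho) ^+ d)%:E * (\prod_i g i (x 0 i))%:E))%E).
  apply: ge0_le_integral_nonmeasurable => x; rewrite patchE; case: ifPn => //.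
  - by rewrite lee_fin mulr_ge0// ?invr_ge0 ?sqrtr_ge0 ?expR_ge0.
  - rewrite inE /= => xl; rewrite -EFinM lee_fin; apply: gauss_pdf_le => //.
    by rewrite divfK ?gt_eqF.
  - move=> _; rewrite -EFinM lee_fin mulr_ge0// exprn_ge0// mulr_ge0 ?sqrtr_ge0//.
    by case/andP: rho01 => /ltW.
rewrite ge0_integralZl_EFin//.
- rewrite integral_rV_prod; last 2 first.
  + by move=> i; exact: measurable_normal_pdf.
  + by move=> i x; exact: normal_pdf_ge0.
  by rewrite big1 ?mule1 ?exprMn// => i _; exact: integral_normal_pdf.
- by move=> x _; rewrite lee_fin.
- apply/measurable_EFinP; apply: measurable_prod => i _.
  exact: (measurableT_comp (measurable_normal_pdf _ _) (measurable_coord 0 i)).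
- by rewrite exprn_ge0// mulr_ge0 ?sqrtr_ge0//; case/andP: rho01 => /ltW.
Qed.

End gaussian_ball.

(** * Auxiliary facts on sigma-algebras, finite sums and hitting times *)

Lemma sigma_algebra_setI T (G : set (set T)) A B :
  sigma_algebra setT G -> G A -> G B -> G (A `&` B).
Proof.
move=> /(sigma_algebraP (fun X _ => @subsetT _ X))[_ _ _ GI]; exact: GI.
Qed.

(** A geometric sum of ratio 2 is at most twice its last term. The bound [c * 2 ^+ J], proved
    alongside, serves the induction step that adds a term. *)
Lemma sum_pow2_below (R : realFieldType) (c y : R) J : 0 <= c -> 0 <= y ->
  \sum_(j < J) (if c * 2 ^+ j < y then c * 2 ^+ j else 0) <= 2 * y.
Proof.
move=> c0 y0.
suff [] : \sum_(j < J) (if c * 2 ^+ j < y then c * 2 ^+ j else 0) <= 2 * y /\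
  \sum_(j < J) (if c * 2 ^+ j < y then c * 2 ^+ j else 0) <= c * 2 ^+ J by [].
elim: J => [|J [IH1 IH2]]; first by rewrite big_ord0 mulr1 mulr_ge0.
have cJ : 0 <= c * 2 ^+ J by rewrite mulr_ge0// exprn_ge0.
rewrite big_ord_recr/= exprS; case: ifPn => cy; split; lra.
Qed.

Lemma sum_indicator_le (R : numDomainType) (a : nat -> R) n t :
  (forall s, a s <= 1) -> (forall s, (t <= s)%N -> a s = 0) ->
  \sum_(s < n) a s <= t%:R.
Proof.
move=> a1 a0.
(* With [t] alone as the bound, the induction could not absorb a new term while [n < t]. *)
suff : \sum_(s < n) a s <= (minn n t)%:R.
  by move/le_trans; apply; rewrite ler_nat geq_minr.
elim: n => [|n IH]; first by rewrite big_ord0 min0n.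
rewrite big_ord_recr/=; have [tn|nt] := leqP t n.
  rewrite a0// addr0 (le_trans IH)// ler_nat.
  by rewrite leq_min geq_minr andbT (leq_trans (geq_minr n t))// leqW.
rewrite (minn_idPl nt) (minn_idPl (ltnW nt)) in IH *.
by rewrite -natr1 lerD.
Qed.

Section hitting.
Context {R : realType} {dO : measure_display} {Omega : measurableType dO}.

Lemma hitting_time_ge0 V (Y : nat -> Omega -> V) D w :
  (0 <= hitting_time (R := R) Y D w)%E.
Proof. by apply: le_ereal_inf_tmp => _ [t _ <-]; rewrite lee_fin. Qed.

Lemma hitting_time_le V V' (Y : nat -> Omega -> V) (Y' : nat -> Omega -> V') D D' w :
  (forall t, D' (Y' t w) -> D (Y t w)) ->
  (hitting_time (R := R) Y D w <= hitting_time Y' D' w)%E.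
Proof.
move=> DD'; apply: ereal_inf_le_tmp => _ [t Dt <-]; exists t => //.
exact: DD'.
Qed.

End hitting.

(** * Levels crossed by the mean *)

Section level_crossing.
Context {R : realType} {d : nat} {dO : measure_display}
  {Omega : measurableType dO}.
Variables (P : probability Omega R) (U : Type) (kappa : R)
  (f : 'rV[R]_d -> R) (srule : @update_rule R d U R) (crule : @update_rule R d U 'M[R]_d)
  (F : nat -> set (set Omega)) (m : nat -> Omega -> 'rV[R]_d)
  (sigma : nat -> Omega -> R) (Sigma : nat -> Omega -> 'M[R]_d)
  (x : nat -> Omega -> 'rV[R]_d) (u : nat -> Omega -> U)
  (m0 xstar : 'rV[R]_d).
Hypotheses (d_gt0 : (0 < d)%N) (kappa_ge1 : 1 <= kappa)
  (m_init : forall w, m 0%N w = m0)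
  (ES : ES_process P kappa f srule crule F m sigma Sigma x u).

Let D t w := enorm (m t w - xstar).
Let K := Num.sqrt kappa ^+ d.
(** This is the event [T > t]. It involves the whole past, since an accepted sample decreases [f]
    but may increase the distance to [xstar]. *)
Let above eps t : set Omega := [set w | forall s, (s <= t)%N -> eps < D s w].
Let outside l t : set Omega := [set w | l < D t w].
Let ball l : set 'rV[R]_d := [set y | enorm (y - xstar) <= l].

Lemma filtration_outside l t : F t (outside l t).
Proof.
apply: (es_mean_adapted ES t (B := [set y | l < enorm (y - xstar)])).
rewrite -[X in measurable X]setTI.
rewrite (_ : [set y | _] = (fun y => enorm (y - xstar)) @^-1` `]l, +oo[).
  exact: measurable_enorm.
by apply/seteqP; split => y /=; rewrite in_itv/= andbT.
Qed.

Lemma filtration_above eps t : F t (above eps t).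
Proof.
have Fs s := es_filtration ES s.
elim: t => [|t IH].
  rewrite (_ : above eps 0 = outside eps 0); first exact: filtration_outside.
  by apply/seteqP; split => w /=; [apply|move=> ? s; rewrite leqn0 => /eqP->].
rewrite (_ : above eps t.+1 = above eps t `&` outside eps t.+1).
  apply: sigma_algebra_setI; first by case: (Fs t.+1).
    by case: (Fs t) => _ _; exact.
  exact: filtration_outside.
apply/seteqP; split => w /=.
  by move=> H; split; [move=> s st; apply: H; exact: leqW|exact: H].
by move=> [H Dt] s; rewrite leq_eqVlt => /predU1P[->//|]; exact: H.
Qed.

Lemma measurable_above eps t : measurable (above eps t).
Proof. by case: (es_filtration ES t) => _ + _; apply; exact: filtration_above. Qed.

Lemma measurable_outside l t : measurable (outside l t).
Proof. by case: (es_filtration ES t) => _ + _; apply; exact: filtration_outside. Qed.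

Lemma measurable_dist t : measurable_fun setT (D t).
Proof.
apply: (measurableT_comp (measurable_enorm xstar)) => _ B mB; rewrite setTI.
by case: (es_filtration ES t) => _ + _; apply; exact: (es_mean_adapted ES t).
Qed.

(** A truncation of [T = \sum_t 1_{T > t}]: if the target is hit at time [t], only indicators of
    times before [t] can be nonzero. *)
Lemma sum_above_le_hitting_time eps n w :
  ((\sum_(t < n) (\1_(above eps t) w : R))%:E <=
   hitting_time (fun t w => enorm (m t w - xstar)) `[0%R, eps] w)%E.
Proof.
apply: le_ereal_inf_tmp => _ [t + <-]; rewrite /= in_itv/= enorm_ge0/= => Dt.
rewrite lee_fin; apply: (sum_indicator_le (a := fun s => \1_(above eps s) w : R)).
  by move=> s; rewrite indicE lern1; case: (_ \in _).
move=> s ts; rewrite indicE memNset//= => /(_ _ ts).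
by rewrite ltNge Dt.
Qed.

(** The first time with [D <= l] is positive, as [D_0 > l]. The mean has just moved, so the
    preceding sample was accepted and lies in the ball; until then all distances exceed
    [l >= eps]. *)
Lemma level_crossed eps l n w : eps <= l -> l < enorm (m0 - xstar) ->
  ~ above eps n w ->
  exists2 t, (t < n)%N & (above eps t `&` outside l t `&` x t @^-1` ball l) w.
Proof.
move=> epsl lD0 /existsNP[s0 /not_implyP[s0n /negP]]; rewrite -leNgt => Ds0.
have ex : exists s, D s w <= l by exists s0; exact: le_trans epsl.
case: (ex_minnP ex) => -[|t] Dt tmin.
  by move: Dt; rewrite /D m_init leNgt lD0.
have lt s : (s <= t)%N -> l < D s w.
  by move=> st; rewrite ltNge; apply/negP => /tmin; rewrite ltnNge st.
exists t.
  exact: leq_trans (tmin _ (le_trans Ds0 epsl)) s0n.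
split; first split; [by move=> s /lt; exact: le_lt_trans|exact: lt|].
move: Dt; rewrite /D (es_mean_update ES); case: ifP => //= _ Dt.
by have := lt t (leqnn t); rewrite /D ltNge Dt.
Qed.

(** The conditions on the means belong to [F t], so the Gaussian bound applies under the integral.
    The factor in [D_t] stays inside, to be summed over the levels path by path. *)
Lemma crossing_probability_le eps l t : 0 < l ->
  (P (above eps t `&` outside l t `&` x t @^-1` ball l) <=
   \int[P]_w (\1_(above eps t `&` outside l t) w *
               (K * (l * (D t w)^-1) ^+ d))%:E)%E.
Proof.
move=> l0; rewrite (es_sample ES); last 2 first.
- apply: sigma_algebra_setI (filtration_above _ _) (filtration_outside _ _).
  by case: (es_filtration ES t).
- rewrite -[X in measurable X]setTI.
  rewrite (_ : ball l = (fun y => enorm (y - xstar)) @^-1` `]-oo, l]).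
    exact: measurable_enorm.
  by apply/seteqP; split => y /=; rewrite in_itv.
rewrite integral_mkcond; apply: ge0_le_integral_nonmeasurable => w.
  rewrite patchE; case: ifPn => // _; apply: integral_ge0 => y _.
  by rewrite lee_fin mulr_ge0// ?invr_ge0 ?sqrtr_ge0 ?expR_ge0.
rewrite patchE indicE; case: ifPn => [|_]; last by rewrite mul0r.
rewrite inE => -[_ Dl]; rewrite mul1r.
apply: gauss_ball_le => //; first exact: lt_le_trans kappa_ge1.
- exact: (es_covariance_S_kappa ES).
- exact: (es_step_size_gt0 ES).
- by rewrite l0 ltW.
Qed.

(** For fixed [w] only the levels below [D_t] contribute; their [l_j^d] sum to at most [2 D_t^d],
    which cancels the denominator whatever [J] is. *)
Lemma sum_crossing_probability_le eps t (l : nat -> R) c J : 0 <= c ->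
  (forall j, 0 < l j) -> (forall j, l j ^+ d = c * 2 ^+ j) ->
  (\sum_(j < J) P (above eps t `&` outside (l j) t `&` x t @^-1` ball (l j)) <=
   (2 * K)%:E * P (above eps t))%E.
Proof.
move=> c0 l0 lE.
have K0 : 0 <= K by rewrite exprn_ge0// sqrtr_ge0.
pose g j w := \1_(above eps t `&` outside (l j) t) w * (K * (l j * (D t w)^-1) ^+ d).
have g0 j w : 0 <= g j w.
  by rewrite mulr_ge0// mulr_ge0// exprn_ge0// mulr_ge0 ?invr_ge0 ?enorm_ge0// ltW.
apply: (@le_trans _ _ (\sum_(j < J) \int[P]_w (g j w)%:E)%E).
  by apply: lee_sum => j _; exact: crossing_probability_le.
rewrite -(@ge0_integral_sum _ _ _ P _ measurableT _ (fun (j : 'I_J) w => (g j w)%:E)); last 2 first.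
- move=> j; apply/measurable_EFinP; apply: measurable_funM.
    apply: measurable_indic; apply: measurableI.
      exact: measurable_above.
    exact: measurable_outside.
  apply: measurable_funM => //; apply: measurable_funX; apply: measurable_funM => //.
  rewrite (_ : (fun w => _) = (@powR R ^~ (-1)) \o D t).
    exact: (measurableT_comp (measurable_powR (-1)) (measurable_dist t)).
  by apply/funext => w /=; rewrite powR_inv1// enorm_ge0.
- by move=> j w _; rewrite lee_fin.
rewrite -[X in P X]setIT -integral_indic//; last exact: measurable_above.
rewrite -ge0_integralZl_EFin//; last 2 first.
- by apply/measurable_EFinP; apply/measurable_indic/measurable_above.
- by rewrite mulr_ge0.
apply: ge0_le_integral_nonmeasurable => w.
  by rewrite sume_ge0// => j _; rewrite lee_fin.
rewrite sumEFin -EFinM lee_fin indicE.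
have [|wA] := boolP (w \in above eps t); last first.
  rewrite mulr0 big1// => j _; rewrite /g indicE in_setI (negbTE wA).
  by rewrite mul0r.
rewrite inE mulr1 => wA.
have D_ge0 : 0 <= D t w by exact: enorm_ge0.
have gE (j : 'I_J) : g j w =
    K / D t w ^+ d * (if c * 2 ^+ j < D t w ^+ d then c * 2 ^+ j else 0).
  have -> : (c * 2 ^+ j < D t w ^+ d) = (l j < D t w).
    by rewrite -lE ltr_pXn2r// nnegrE// ltW.
  rewrite -lE /g indicE; case: ifPn => jD.
    rewrite mem_set; last by split.
    rewrite mul1r exprMn exprVn.
    by rewrite mulrCA mulrC.
  by rewrite memNset ?mul0r ?mulr0// => -[_]; rewrite /outside/= (negbTE jD).
under eq_bigr do rewrite gE.
(* A negative [eps] leaves room for [D_t = 0]; the factor [K / D_t^d] is then 0 by the convention on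
   inverses. *)
rewrite -mulr_sumr; have [D0|D0] := eqVneq (D t w) 0.
  by rewrite D0 expr0n gtn_eqF// invr0 mulr0 mul0r mulr_ge0.
have Dd_gt0 : 0 < D t w ^+ d by rewrite exprn_gt0// lt_neqAle eq_sym D0.
rewrite mulrAC ler_pdivrMr// [2 * K]mulrC -mulrA ler_wpM2l//.
exact: sum_pow2_below (ltW Dd_gt0).
Qed.

(** Expected crossings are counted in two ways: by a union bound over times, each of the [J] levels
    is crossed before [n] with probability at least [1 - P(T > n)], while iteration [t] contributes
    at most [2 K P(T > t)]. *)
Lemma level_count_le eps (l : nat -> R) c J n : 0 <= c ->
  (forall j, eps <= l j) -> (forall j, 0 < l j) ->
  (forall j, l j ^+ d = c * 2 ^+ j) ->
  (forall j, (j < J)%N -> l j < enorm (m0 - xstar)) ->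
  J%:R * (1 - fine (P (above eps n))) <=
  2 * K * \sum_(t < n) fine (P (above eps t)).
Proof.
move=> c0 epsl l0 lE lD0.
have mA t := measurable_above eps t.
have PE t : P (above eps t) = (fine (P (above eps t)))%:E.
  by rewrite fineK// fin_num_measure.
rewrite -lee_fin EFinM [leRHS]EFinM -sumEFin.
under eq_bigr do rewrite -PE.
rewrite ge0_sume_distrr//.
pose A j t := above eps t `&` outside (l j) t `&` x t @^-1` ball (l j).
have mAj j t : measurable (A j t).
  apply: measurableI.
    by apply: measurableI => //; exact: measurable_outside.
  have [_ + _] := es_filtration ES t.+1; apply; apply: (es_sample_adapted ES).
  rewrite -[X in measurable X]setTI.
  rewrite (_ : ball (l j) = (fun y => enorm (y - xstar)) @^-1` `]-oo, l j]).
    exact: measurable_enorm.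
  by apply/seteqP; split => y /=; rewrite in_itv.
have cross j : (j < J)%N -> (1 - P (above eps n) <= \sum_(t < n) P (A j t))%E.
  move=> jJ; rewrite -probability_setC//; apply: content_subadditive => //.
    exact: measurableC.
  move=> w /= /(level_crossed (epsl j) (lD0 j jJ))[t tn At].
  by rewrite -bigcup_mkord; exists t.
apply: (@le_trans _ _ (\sum_(j < J) \sum_(t < n) P (A j t))%E).
  apply: (@le_trans _ _ (\sum_(j < J) (1 - P (above eps n)))%E).
    have -> : (1 - P (above eps n))%E = (1 - fine (P (above eps n)))%:E.
      by rewrite EFinB -PE.
    by rewrite sumEFin sumr_const card_ord -EFinM mulr_natl.
  by apply: lee_sum => j _; exact: cross.
rewrite exchange_big/=; apply: lee_sum => t _.
rewrite /A; exact: (sum_crossing_probability_le _ _ _ c0).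
Qed.

Lemma expected_hitting_time_ge eps : 0 < eps ->
  ((- 2^-1 + d%:R / (4 * kappa `^ (d%:R / 2)) *
      ln (enorm (m0 - xstar) / eps))%:E <=
   \int[P]_w hitting_time (fun t w => enorm (m t w - xstar)) `[0%R, eps] w)%E.
Proof.
move=> eps0; set T := hitting_time _ _; set L := ln _.
have T0 w : (0 <= T w)%E by exact: hitting_time_ge0.
have d0 : 0 < d%:R :> R by rewrite ltr0n.
have k0 : 0 < kappa by exact: lt_le_trans kappa_ge1.
have KE : kappa `^ (d%:R / 2) = K.
  by rewrite mulrC powRrM powR12_sqrt ?ltW// powR_mulrn// sqrtr_ge0.
have K1 : 1 <= K.
  by rewrite exprn_ege1// -sqrtr1 ler_wsqrtr.
(* For [L <= 0] the bound is negative. This includes [m0 = xstar], where [ln 0 = 0]. *)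
rewrite KE; have [L0|L0] := leP L 0.
  apply: (@le_trans _ _ 0%E); last exact: integral_ge0.
  rewrite lee_fin; have : d%:R / (4 * K) * L <= 0.
    by rewrite mulr_ge0_le0// divr_ge0// mulr_ge0// (le_trans _ K1).
  lra.
have D0 : 0 < enorm (m0 - xstar).
  rewrite lt_neqAle enorm_ge0 andbT eq_sym; apply: contraTneq L0 => D0.
  by rewrite /L D0 mul0r ln0 ?ltxx.
have l2 : 0 < ln 2 :> R by rewrite ln_gt0// ltr1n.
have l21 : ln 2 <= 1 :> R.
  by apply: (@le_ln1Dx R 1); lra.
(* That is [eps * 2^(j/d)]. As [eps * 2^(J/d) <= D_0], the levels of index [0, ..., J-1] are
   strictly below [D_0]. *)
pose l j := eps * expR (j%:R * (ln 2 / d%:R)).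
pose J := Num.truncn (d%:R * L / ln 2).
have J0 : 0 <= d%:R * L / ln 2 by rewrite divr_ge0 ?mulr_ge0// ltW.
have /andP[JL LJ] := truncn_itv J0; rewrite -/J in JL LJ.
have lE j : l j ^+ d = eps ^+ d * 2 ^+ j.
  rewrite exprMn -expRM_natr -mulrA divfK ?gt_eqF// expRM_natl lnK//.
  by rewrite posrE.
have epsl j : eps <= l j.
  by rewrite ler_peMr ?(ltW eps0)// -[leLHS]expR0 ler_expR mulr_ge0// divr_ge0// ltW.
have lD0 j : (j < J)%N -> l j < enorm (m0 - xstar).
  move=> jJ; rewrite -ltr_pdivlMl// [ltRHS]mulrC -[ltRHS]lnK ?posrE ?divr_gt0//.
  rewrite ltr_expR mulrA ltr_pdivrMr// -/L [L * _]mulrC.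
  move: JL; rewrite ler_pdivlMr//; apply: lt_le_trans.
  by rewrite ltr_pM2r// ltr_nat.
have count n := @level_count_le eps l (eps ^+ d) J n (ltW (exprn_gt0 _ eps0))
  epsl (fun j => lt_le_trans eps0 (epsl j)) lE lD0.
have mA t := measurable_above eps t.
have PE t : P (above eps t) = (fine (P (above eps t)))%:E.
  by rewrite fineK// fin_num_measure.
pose p t := fine (P (above eps t)).
have p_le s t : (s <= t)%N -> p t <= p s.
  move=> st; rewrite -lee_fin -!PE le_measure ?inE// => w wt r rs.
  by apply: wt; exact: leq_trans st.
have sum_p n : ((\sum_(t < n) p t)%:E <= \int[P]_w T w)%E.
  apply: (@le_trans _ _ (\int[P]_w (\sum_(t < n) (\1_(above eps t) w)%:E))%E); last first.
    apply: ge0_le_integral_nonmeasurable => w.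
      by apply: sume_ge0 => t _; rewrite lee_fin.
    by rewrite sumEFin; exact: sum_above_le_hitting_time.
  rewrite ge0_integral_sum//; last first.
    by move=> t; apply/measurable_EFinP; exact: measurable_indic.
  rewrite -sumEFin; apply: lee_sum => t _.
  by rewrite integral_indic// setIT -PE.
case: (\int[P]_w T w)%E sum_p => [e| |] sum_p; last 2 first.
- by rewrite leey.
- by have := sum_p 0%N; rewrite leeNy_eq.
have {}sum_p n : \sum_(t < n) p t <= e by rewrite -lee_fin.
have e0 : 0 <= e by have := sum_p 0%N; rewrite big_ord0.
(* This replaces letting [n] tend to infinity in the count. Since [p] is nonincreasing,
   [n p_n <= e]; if [del = J - 2 K e] were positive, then [del <= J p_n] and [n del <= J e] for all
   [n], which fails for [n > J e / del]. *)
have J2e : J%:R <= 2 * K * e.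
  rewrite leNgt; apply/negP; rewrite -subr_gt0; set del := _ - _ => del0.
  pose n := (Num.truncn (J%:R * e / del)).+1.
  have np : n%:R * p n <= e.
    apply: le_trans (sum_p n); rewrite -[n in n%:R]card_ord -sumr_const mulr_suml.
    by apply: ler_sum => i _; rewrite mul1r p_le// ltnW.
  have Jn : J%:R * e < n%:R * del.
    rewrite -ltr_pdivrMr//; exact: truncnS_gt.
  have := count n; rewrite -/(p _) => cn.
  have {}cn : J%:R * (1 - p n) <= 2 * K * e.
    apply: le_trans cn _; rewrite ler_wpM2l// mulr_ge0// (le_trans _ K1)//.
  have n0 : 0 <= n%:R :> R by [].
  have := ler_wpM2l n0 cn.
  have JR : 0 <= J%:R :> R by [].
  have := ler_wpM2l JR np.
  rewrite /del in Jn; nra.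
rewrite lee_fin.
(* Rounding to the integer [J] costs at most one level. As [ln 2 <= 1 <= K], the right side is at
   most [4 K (e + 1/2)]. *)
have Ji : d%:R * L <= ln 2 * (2 * K * e + 1).
  rewrite -ler_pdivrMl// mulrC; apply: le_trans (ltW LJ) _.
  by rewrite -natr1 lerD2r.
have K4 : 0 < 4 * K by rewrite mulr_gt0// (lt_le_trans _ K1).
rewrite -lerBrDl mulrAC ler_pdivrMr//.
have KE2 : 0 <= 2 * K * e + 1 by rewrite addr_ge0// !mulr_ge0// (le_trans _ K1).
have := ler_wpM2r KE2 l21; nra.
Qed.

End level_crossing.

(** * From the distance to the suboptimality function *)

Section suboptimality.
Variables (R : realType) (d : nat) (f : 'rV[R]_d -> R).
Hypothesis mf : measurable_fun setT f.

Lemma f_mu_le y z : f y <= f z -> (f_mu f y <= f_mu f z)%E.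
Proof.
move=> fyz.
have msub c : measurable [set y | f y <= c].
  rewrite -[X in measurable X]setTI.
  rewrite (_ : [set y | _] = f @^-1` `]-oo, c]); first exact: mf.
  by apply/seteqP; split => v /=; rewrite in_itv.
apply: gt0_ler_poweR; rewrite ?invr_ge0//.
- by rewrite /= in_itv/= leey andbT.
- by rewrite /= in_itv/= leey andbT.
by rewrite le_measure// ?inE// => v /= /le_trans; apply.
Qed.

(** A1 encloses the sublevel set of [y] in a ball of radius at most [Cu * r]. Its center is
    arbitrary, so only the diameter is controlled. *)
Lemma A1_diameter (a b : \bar R) (Cl Cu r : R) y z z' : 0 < Cu ->
  A1 f a b Cl Cu -> level_band f a b y -> (f_mu f y <= r%:E)%E ->
  (f_mu f z <= f_mu f y)%E -> (f_mu f z' <= f_mu f y)%E ->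
  enorm (z - z') <= 2 * Cu * r.
Proof.
move=> Cu0 A1f /A1f[_ [c [_ sub]]] yr zy z'y.
have bound v : (f_mu f v <= f_mu f y)%E -> enorm (v - c) <= Cu * r.
  move=> /sub /= vc; rewrite -lee_fin EFinM; apply: le_trans vc _.
  by rewrite lee_pmul2l// lte_fin.
have [zc z'c] := (bound _ zy, bound _ z'y).
have Cr : 0 <= Cu * r := le_trans (enorm_ge0 _) zc.
have Cr2 : 0 <= 2 * (Cu * r) by exact: mulr_ge0.
rewrite -mulrA -(@ler_pXn2r _ 2)// ?nnegrE ?enorm_ge0//.
(* This consequence of the parallelogram law is as sharp as the triangle inequality here, both
   distances having the same bound. *)
apply: (@le_trans _ _ (2 * enorm (z - c) ^+ 2 + 2 * enorm (z' - c) ^+ 2)).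
  rewrite !enorm_sqr !mulr_sumr -big_split/=; apply: ler_sum => i _.
  by rewrite !mxE; have := sqr_ge0 (z 0 i + z' 0 i - 2 * c 0 i); nra.
have sq v : enorm (v - c) <= Cu * r -> enorm (v - c) ^+ 2 <= (Cu * r) ^+ 2.
  by move=> vc; rewrite lerXn2r// nnegrE enorm_ge0.
by have := (sq _ zc, sq _ z'c); case; lra.
Qed.

End suboptimality.

Theorem theorem4p7 (R : realType) (d : nat) (kappa : R) (f : 'rV[R]_d -> R)
    (dO : measure_display) (Omega : measurableType dO) (P : probability Omega R)
    (U : Type) (crule : update_rule U 'M[R]_d) (F : nat -> set (set Omega))
    (m : nat -> Omega -> 'rV[R]_d) (sigma : nat -> Omega -> R)
    (Sigma : nat -> Omega -> 'M[R]_d) (x : nat -> Omega -> 'rV[R]_d)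
    (u : nat -> Omega -> U) (m0 xstar : 'rV[R]_d) (eps : R)
    (d_ge2 : (2 <= d)%N) (kappa_ge1 : 1 <= kappa) (eps_gt0 : 0 < eps)
    (mf : measurable_fun setT f)
    (crule_comparison : comparison_based crule)
    (m_init : forall w, m 0%N w = m0) :
  let lower_bound (rho : R) : \bar R :=
    (- 2^-1 + d%:R / (4 * kappa `^ (d%:R / 2)) *
                ln (enorm (m0 - xstar) / rho))%:E in
  let T_eps : Omega -> \bar R :=
    hitting_time (fun t w => enorm (m t w - xstar)) `[0, eps] in
  [/\ forall alpha_up alpha_down : R,
        1 < alpha_up -> 0 < alpha_down < 1 ->
        ES_process P kappa f (success_rule alpha_up alpha_down) crule
          F m sigma Sigma x u ->
        (lower_bound eps <= \int[P]_w T_eps w)%E,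
      forall srule : update_rule U R,
        ES_process P kappa f srule crule F m sigma Sigma x u ->
        (lower_bound eps <= \int[P]_w T_eps w)%E
    & forall (srule : update_rule U R) (a b : \bar R) (Cl Cu : R),
        ES_process P kappa f srule crule F m sigma Sigma x u ->
        (0 <= a < b)%E -> 0 < Cl -> 0 < Cu -> A1 f a b Cl Cu ->
        (forall y, f xstar <= f y) ->
        (* the level r is in the range where A1 is available *)
        let r : R := 2 * Cl * eps in
        (f_mu f m0 <= b)%E \/ (r%:E <= b)%E ->
        (exists2 y, level_band f a b y & (f_mu f y <= r%:E)%E) ->
        (lower_bound (2 * Cu * r)%R <=
         \int[P]_w hitting_time (fun t w => f_mu f (m t w)) `[0, r%:E] w)%E].
Proof.
move=> lower_bound T_eps.
have d_gt0 : (0 < d)%N by exact: leq_trans d_ge2.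
split.
- by move=> ? ? _ _ ES; exact: (expected_hitting_time_ge _ d_gt0 kappa_ge1 m_init ES).
- by move=> srule ES; exact: (expected_hitting_time_ge _ d_gt0 kappa_ge1 m_init ES).
move=> srule a b Cl Cu ES /andP[a0 ab] Cl0 Cu0 A1f xmin r rb [y yband yr].
have r0 : 0 < r by rewrite !mulr_gt0.
have rho0 : 0 < 2 * Cu * r by rewrite !mulr_gt0.
(* On every path, [f_mu (m_t) <= r] forces [|m_t - xstar| <= 2 Cu r], because the minimizer [xstar]
   lies in each sublevel set of [f]. *)
apply: le_trans (expected_hitting_time_ge xstar d_gt0 kappa_ge1 m_init ES rho0) _.
apply: ge0_le_integral_nonmeasurable => w; first exact: hitting_time_ge0.
apply: hitting_time_le => t; rewrite /= !in_itv/= enorm_ge0/= => /andP[_ mr].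
have f_le0 : f (m t w) <= f m0.
  elim: t {mr} => [|t IH]; first by rewrite m_init.
  by rewrite (es_mean_update ES); case: ifP => // /le_trans; apply.
have mb : (f_mu f (m t w) <= b)%E.
  by case: rb => [|/(le_trans mr)//]; apply: le_trans; exact: f_mu_le.
(* A1 is applied at [m_t] if it lies in the band. Otherwise [f_mu (m_t) <= a < f_mu y], and the
   sublevel set of [y] contains both points. *)
have [am|ma] := ltP a (f_mu f (m t w)).
  by apply: (A1_diameter Cu0 A1f _ mr) => //; [rewrite /level_band/= am|exact: f_mu_le].
have /andP[ay _] := yband.
apply: (A1_diameter Cu0 A1f yband yr); first exact: le_trans ma (ltW ay).
apply: le_trans (le_trans ma (ltW ay)); exact: f_mu_le.
Qed.
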